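(* Let $\Psi=\sum_{j=1}^N c_j\,\mathbf{w}(f_j,g_j)\in\mathcal{V}$ be any finite wave packet with distinct frequencies $f_j\in\mathbb{Q}/\mathbb{Z}$ (where $c_j\in\mathbb{C}$, $g_j\in\mathbb{Q}$), and let $f_0\in\mathbb{Q}/\mathbb{Z}$. Then $$\Pi_{f_0}(\Psi)=\begin{cases}c_{j_0}e^{2\pi ig_{j_0}}\,\mathbf{w}(f_0,0)=c_{j_0}\mathbf{w}(f_0,g_{j_0}),&\text{if }f_0=f_{j_0}\text{ for some }j_0,\\\mathbf{0},&\text{if }f_0\notin\{f_1,\dots,f_N\}.\end{cases}$$ The spectral projection operators satisfy $\Pi_{f_1}\circ\Pi_{f_2}=\delta_{f_1,f_2}\Pi_{f_1}$ (for frequencies $f_1,f_2\in\mathbb{Q}/\mathbb{Z}$), forming a complete projection-valued measure (PVM) on the momentum spectrum.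
   Context: For $f\in\mathbb{Q}/\mathbb{Z}$ and $g\in\mathbb{Q}$, $\mathbf{w}(f,g)[m]=\exp(2\pi i(fm+g))$ for $m\in\mathbb{Z}$, and $\mathcal{V}=\operatorname{span}_{\mathbb{C}}\{\mathbf{w}(f,g)\mid f\in\mathbb{Q}/\mathbb{Z},\,g\in\mathbb{Q}\}$, a space of periodic sequences. For $u,v\in\mathcal{V}$ with fundamental periods $n_u,n_v$, the inner product is $\langle u,v\rangle=\frac1L\sum_{m=1}^L u[m]\overline{v[m]}$ with $L=\operatorname{lcm}(n_u,n_v)$. For $f_0\in\mathbb{Q}/\mathbb{Z}$ the spectral frequency sieve $\Pi_{f_0}:\mathcal{V}\to\mathcal{V}$ is $$\Pi_{f_0}(\Psi)=\langle\Psi,\mathbf{w}(f_0,0)\rangle\,\mathbf{w}(f_0,0).$$ The momentum spectrum is the set of frequencies $\mathbb{Q}/\mathbb{Z}$, $\delta$ is the Kronecker delta on $\mathbb{Q}/\mathbb{Z}$, and $\mathbf{0}$ is the zero sequence. *)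

(* Defs.v *)
From HB Require Import structures.
From mathcomp Require Import all_boot all_order all_algebra archimedean.
From mathcomp Require Import generic_quotient ring_quotient.
From mathcomp Require Import all_classical all_reals all_analysis.
From mathcomp Require Import complex.

Set Implicit Arguments.
Unset Strict Implicit.
Unset Printing Implicit Defensive.

Import Order.TTheory GRing.Theory Num.Theory.
Import numFieldNormedType.Exports.

Local Open Scope classical_set_scope.
Local Open Scope ring_scope.
Local Open Scope quotient_scope.
Local Open Scope complex_scope.

Definition rat_int : {pred rat} := [pred x | x \in Num.int].

Lemma rat_int_zmod_closed : zmod_closed rat_int.
Proof.
by split=> [|x y]; rewrite !inE; [exact: rpred0|exact: rpredB].
Qed.

HB.instance Definition _ :=
  GRing.isZmodClosed.Build rat rat_int rat_int_zmod_closed.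

(* The group Q/Z; the class of [x : rat] is [\pi_QZ x]. *)
Definition QZ : Type := Quotient.quot rat_int.
HB.instance Definition _ := GRing.Zmodule.on QZ.
HB.instance Definition _ := EqQuotient.on QZ.

Lemma QZ_eq (x y : rat) : (\pi_QZ x == \pi_QZ y) = (x - y \in Num.int).
Proof. by rewrite eqmodE. Qed.

Section PeriodicSequences.
Variable R : realType.
Implicit Types (f : QZ) (g x : rat).

Definition cexp (z : R[i]) : R[i] :=
  (expR (complex.Re z))%:C *
  (cos (complex.Im z) +i* sin (complex.Im z)).

Definition e2pi x : R[i] := cexp ('i * (2 * pi * ratr x)%:C).

Local Notation sequence := (int -> R[i]^o).

(* The integer [m] makes the choice of the representative of [f] irrelevant:
   see [wseqE]. *)
Definition wseq f g : sequence := fun m => e2pi (repr f * m%:~R + g).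

Definition Vset : {pred sequence} := fun u =>
  `[< exists s : seq (R[i] * (QZ * rat)),
        u = \sum_(t <- s) t.1 *: wseq t.2.1 t.2.2 >].

Lemma e2piE x :
  e2pi x = cos (2 * pi * ratr x) +i* sin (2 * pi * ratr x).
Proof.
rewrite /e2pi /cexp /= !(mul0r, mul1r, mulr0, subr0, add0r, addr0).
by rewrite oppr0 expR0 mul1r.
Qed.

Lemma e2piD x y : e2pi (x + y) = e2pi x * e2pi y.
Proof.
rewrite !e2piE rmorphD mulrDr cosD sinD.
by apply/eqP; rewrite eq_complex /= eqxx /= addrC.
Qed.

Lemma e2pi_nat n : e2pi n%:R = 1.
Proof.
elim: n => [|n IHn]; first by rewrite e2piE rmorph0 mulr0 cos0 sin0.
rewrite -natr1 e2piD IHn mul1r e2piE rmorph1 mulr1 mulr_natl.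
by rewrite cos2pi sin2pi.
Qed.

Lemma e2pi_int (k : int) : e2pi k%:~R = 1.
Proof.
case: k => n; first by rewrite -pmulrn e2pi_nat.
have := e2piD (Negz n)%:~R (n.+1)%:R.
by rewrite e2pi_nat mulr1 NegzE rmorphN /= -pmulrn addNr (e2pi_nat 0) => <-.
Qed.

Lemma wseqE x g (m : int) : wseq (\pi_QZ x) g m = e2pi (x * m%:~R + g).
Proof.
have : (repr (\pi_QZ x) - x) \in Num.int by rewrite -QZ_eq reprK.
move=> /intrP[k /eqP]; rewrite subr_eq => /eqP xk.
by rewrite /wseq xk mulrDl -intrM -addrA e2piD e2pi_int mul1r.
Qed.

Lemma Vset_submod_closed : submod_closed Vset.
Proof.
split=> [|a u v].
  by apply/asboolP; exists [::]; rewrite big_nil.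
move=> /asboolP[s ->] /asboolP[t ->]; apply/asboolP.
exists ([seq (a * p.1, p.2) | p <- s] ++ t); rewrite big_cat big_map /=.
by rewrite scaler_sumr; congr (_ + _); apply: eq_bigr => p _; rewrite scalerA.
Qed.

HB.instance Definition _ :=
  GRing.isSubmodClosed.Build R[i] sequence Vset Vset_submod_closed.

Record V : Type := InV { sequence_of_V :> sequence; _ : sequence_of_V \in Vset }.
HB.instance Definition _ := [isSub for sequence_of_V].
HB.instance Definition _ := [Choice of V by <:].
HB.instance Definition _ := [SubChoice_isSubLmodule of V by <:].

Lemma wseqV f g : wseq f g \in Vset.
Proof.
by apply/asboolP; exists [:: (1, (f, g))]; rewrite big_seq1 scale1r.
Qed.

Definition w f g : V := InV (wseqV f g).

Definition is_period (u : sequence) (n : nat) :=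
  (0 < n)%N /\ forall m : int, u (m + n%:Z) = u m.

Definition is_fundamental_period (u : sequence) (n : nat) :=
  is_period u n /\ forall k, is_period u k -> (n <= k)%N.

(* [0] for a sequence that is not periodic. *)
Definition fundamental_period (u : sequence) : nat :=
  xget 0%N [set n | is_fundamental_period u n].

Lemma fundamental_periodP (u : V) :
  is_fundamental_period u (fundamental_period u).
Proof.
have wP f g : exists n, is_period (wseq f g) n.
  exists `|denq (repr f)|%N; split=> [|m].
    by rewrite absz_gt0 denq_neq0.
  rewrite /wseq abszE ger0_norm ?denq_ge0// rmorphD/= mulrDr.
  have -> : repr f * (denq (repr f))%:~R = (numq (repr f))%:~R.
    by rewrite mulrC numqE mulrC.
  by rewrite addrAC e2piD e2pi_int mulr1.
have mulP (v : sequence) n k : is_period v n -> (0 < k)%N -> is_period v (k * n).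
  move=> [n0 vn] k0; split=> [|m]; first by rewrite muln_gt0 k0.
  elim: {k0}k m => [|k IHk] m; first by rewrite mul0n addr0.
  by rewrite mulSn PoszD addrA IHk vn.
have [n nP] : exists n, is_period u n.
  case: u => v /= /asboolP[s ->] {v}; elim: s => [|[a [f g]] s [n nP]].
    by rewrite big_nil; exists 1%N; split.
  have [k kP] := wP f g; rewrite big_cons /=.
  exists (k * n)%N; split=> [|m]; first by rewrite muln_gt0 kP.1 nP.1.
  have [_ /(_ m) e1] := mulP _ _ _ nP kP.1.
  have [_ /(_ m) e2] := mulP _ _ _ kP nP.1.
  rewrite mulnC in e2.
  by rewrite !fctE/= e1; congr (_ + _); rewrite -[RHS]/(a *: wseq f g m) -e2.
have exP : exists n, `[< is_period u n >] by exists n; apply/asboolP.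
apply: (@xgetPex _ 0%N [set n | is_fundamental_period u n]).
case: (ex_minnP exP) => k /asboolP kP kmin; exists k; split=> // j jP.
by apply: kmin; apply/asboolP.
Qed.

Definition inner (u v : V) : R[i] :=
  let L := lcmn (fundamental_period u) (fundamental_period v) in
  (L%:R : R[i])^-1 * \sum_(1 <= m < L.+1) (u m%:Z : R[i]) * (v m%:Z : R[i])^*.

Definition normV (u : V) : R := Num.sqrt (complex.Re (inner u u)).

Definition sieve f (Psi : V) : V := inner Psi (w f 0) *: w f 0.

Definition orthogonal_projection (T : V -> V) :=
  [/\ linear T, T \o T = T & forall u v, inner (T u) v = inner u (T v)].

(* Projection-valued measures on the discrete space Q/Z, all of whose subsets
   are measurable; countable additivity is in the strong operator topology. *)
Definition is_PVM (E : set QZ -> V -> V) :=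
  [/\ forall S, orthogonal_projection (E S),
      E set0 = (fun=> 0),
      E setT = id,
      forall S T, E (S `&` T) = E S \o E T
    & forall F : nat -> set QZ, trivIset setT F -> forall Psi : V,
        (fun n => normV (\sum_(k < n) E (F k) Psi - E (\bigcup_k F k) Psi))
          @ \oo --> (0 : R)].

Definition spectral_measure (P : QZ -> V -> V) (S : set QZ) (Psi : V) : V :=
  \sum_(f \in S) P f Psi.

(* [P f] is the value of the measure at the singleton [[set f]].  The value
   [id] at [setT] is the completeness relation [\sum_f P f = id]; each sum is
   finite by the first condition. *)
Definition complete_PVM (P : QZ -> V -> V) :=
  (forall Psi, finite_set [set f | P f Psi != 0]) /\
  is_PVM (spectral_measure P).

End PeriodicSequences.

Arguments V R : clear implicits.
Arguments w R f g : clear implicits.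
Arguments e2pi R x : clear implicits.
Arguments sieve R f Psi : clear implicits.

(* Main.v *)
Require Import Defs.
From HB Require Import structures.
From mathcomp Require Import all_boot all_order all_algebra archimedean.
From mathcomp Require Import generic_quotient ring_quotient.
From mathcomp Require Import all_classical all_reals all_analysis.
From mathcomp Require Import complex ring lra.

Set Implicit Arguments.
Unset Strict Implicit.
Unset Printing Implicit Defensive.

Import Order.TTheory GRing.Theory Num.Theory.
Import numFieldNormedType.Exports.

Local Open Scope ring_scope.

(** The inner product is an average over a common period, and such an average
depends neither on the common period nor on a shift of the sequence
([mean_indep], [mean_shift]).  The first fact gives sesquilinearity, although
[inner] is written with the fundamental periods of its arguments, which change
under addition.  The second gives orthogonality: the shift by one multiplies
[w f g * (w f' g')^*] by the root of unity [exp (2 pi i (f - f'))], which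
differs from [1] when [f] and [f'] are distinct in Q/Z, so the average of that
product vanishes ([inner_w]).

Since [w f g = exp (2 pi i g) *: w f 0], the sequences [w f 0] are an
orthonormal family that spans the space, and [sieve h] is the coordinate
projection on [w h 0]; this is the formula for wave packets and the composition
law.  For a set [S] of frequencies, [spectral_measure (sieve R) S] is then the
linear map that fixes [w f 0] for [f] in [S] and kills it otherwise
([spectral_measure_w]).  The algebraic axioms of a projection-valued measure are
identities between expressions linear, or conjugate linear, in each vector; by
induction on the span ([V_ind]) they need a proof on the [w f 0] only, which
is a computation with indicator functions.  Countable additivity holds in a
strong form: a vector involves finitely many frequencies, so the partial sums
are eventually equal to their limit. *)

(** * The exponential as a character of Q/Z *)

Section Exponential.
Variable R : realType.
Implicit Types x y : rat.

Lemma e2pi0 : e2pi R 0 = 1.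
Proof. exact: (e2pi_nat R 0). Qed.

Lemma conj_e2pi x : ((e2pi R x)^*)%C = e2pi R (- x).
Proof. by rewrite !e2piE rmorphN mulrN cosN sinN. Qed.

(** With the integer part of [x] removed, [1 - cos (2 pi r) = 2 sin (pi r) ^ 2]
vanishes for some [0 <= r < 1], while [sin] is positive on [(0, pi)]. *)
Lemma e2pi_eq1 x : e2pi R x = 1 -> x \in Num.int.
Proof.
move=> x1; pose r := x - (Num.floor x)%:~R.
have r1 : e2pi R r = 1.
  have := e2piD R r (Num.floor x)%:~R.
  by rewrite subrK x1 e2pi_int mulr1 => <-.
have r_ge0 : 0 <= r by rewrite subr_ge0 floor_le.
have r_lt1 : r < 1 by rewrite ltrBlDl -intrD1 floorD1_gt.
suff r0 : r = 0.
  by rewrite -[x](subrK (Num.floor x)%:~R) -/r r0 add0r intr_int.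
apply/eqP; rewrite eq_le r_ge0 andbT leNgt; apply/negP => r_gt0.
have s0 : 0 < sin (pi * ratr r : R).
  apply: sin_gt0_pi; rewrite mulr_gt0 ?pi_gt0 ?ltr0q//=.
  by rewrite gtr_pMr ?pi_gt0// -(rmorph1 (@ratr R)) ltr_rat.
move/(congr1 (@complex.Re R)): r1; rewrite e2piE/= -mulrA mulr_natl cos_mulr2n.
rewrite cos2sin2 => sE.
have /eqP : sin (pi * ratr r : R) ^+ 2 = 0 by lra.
by rewrite sqrf_eq0 gt_eqF.
Qed.

Lemma e2pi_reprB_eq1 (f f' : QZ) : e2pi R (repr f - repr f') = 1 -> f = f'.
Proof. by move=> /e2pi_eq1; rewrite -QZ_eq !reprK => /eqP. Qed.

End Exponential.

(** * Averages over a period and the inner product *)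

Section Averages.
Variable R : realType.
Implicit Types (F : int -> R[i]^o) (u v : V R).

Lemma is_period_mul F n k : is_period F n -> (0 < k)%N -> is_period F (k * n).
Proof.
move=> [n0 Fn] k0; split=> [|m]; first by rewrite muln_gt0 k0.
elim: {k0}k m => [|k IHk] m; first by rewrite mul0n addr0.
by rewrite mulSn PoszD addrA IHk Fn.
Qed.

Lemma is_period_dvd F n k :
  is_period F n -> (0 < k)%N -> (n %| k)%N -> is_period F k.
Proof.
move=> Fn k0 /dvdnP[q kE]; rewrite kE; apply: is_period_mul => //.
by move: k0; rewrite kE muln_gt0 => /andP[].
Qed.

Definition mean F (n : nat) : R[i] :=
  n%:R^-1 * \sum_(1 <= m < n.+1) (F m%:Z : R[i]).

Lemma mean_mul F n k : is_period F n -> (0 < k)%N -> mean F (k * n) = mean F n.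
Proof.
move=> Fn k0; have n0 := Fn.1.
have sumM j : \sum_(1 <= m < (j * n).+1) (F m%:Z : R[i])
            = (\sum_(1 <= m < n.+1) (F m%:Z : R[i])) *+ j.
  elim: j => [|j IHj]; first by rewrite mul0n big_geq.
  rewrite mulrS addrC mulSn addnC.
  rewrite (@big_cat_nat _ _ _ (j * n).+1) ?ltnS ?leq_addr//=.
  rewrite IHj; congr (_ + _).
  rewrite -[(j * n).+1]add1n big_addn subSn ?leq_addr// addKn.
  apply: eq_bigr => m _; case: j {IHj} => [|j]; first by rewrite mul0n addn0.
  by rewrite PoszD (is_period_mul Fn (ltn0Sn j)).2.
rewrite /mean sumM -[_ *+ k]mulr_natl mulrA natrM invfM.
rewrite [X in X * _]mulrAC mulVf ?mul1r//.
by rewrite pnatr_eq0 -lt0n.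
Qed.

Lemma mean_indep F n k : is_period F n -> is_period F k -> mean F n = mean F k.
Proof.
move=> Fn Fk.
by rewrite -(mean_mul Fn Fk.1) mulnC (mean_mul Fk Fn.1).
Qed.

(** By periodicity, the term [F (n + 1)] that enters equals the term [F 1] that
leaves. *)
Lemma mean_shift F n : is_period F n -> mean (fun m => F (m + 1)) n = mean F n.
Proof.
move=> [n0 Fn]; rewrite /mean; congr (_ * _).
rewrite big_nat_recr//= [RHS]big_ltn//.
rewrite -[n%:Z + 1]addrC Fn addrC; congr (_ + _).
by rewrite [RHS]big_add1; apply: eq_bigr => m _; rewrite -PoszD addn1.
Qed.

Lemma period_fundamental u : is_period u (fundamental_period u).
Proof. by case: (fundamental_periodP u). Qed.

(** The least common multiple of the fundamental periods that defines [inner]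
may be replaced by any common period, for instance by one shared with a third
sequence. *)
Lemma innerE u v n : is_period u n -> is_period v n ->
  inner u v = mean (fun m => u m * (v m : R[i])^*%C) n.
Proof.
move=> un vn; apply: mean_indep; last first.
  by split=> [|m]; [exact: un.1|rewrite un.2 vn.2].
have Pu := period_fundamental u; have Pv := period_fundamental v.
have L0 : (0 < lcmn (fundamental_period u) (fundamental_period v))%N.
  by rewrite lcmn_gt0 Pu.1 Pv.1.
split=> // m; rewrite (is_period_dvd Pu L0 (dvdn_lcml _ _)).2.
by rewrite (is_period_dvd Pv L0 (dvdn_lcmr _ _)).2.
Qed.

Lemma common_period2 u v : exists2 n, is_period u n & is_period v n.
Proof.
have Pu := period_fundamental u; have Pv := period_fundamental v.
exists (fundamental_period u * fundamental_period v)%N.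
  by rewrite mulnC; apply: is_period_mul => //; exact: Pv.1.
by apply: is_period_mul => //; exact: Pu.1.
Qed.

Lemma inner_linear v : linear (fun u => inner u v : R[i]^o).
Proof.
move=> a u u'.
have [n un u'n] := common_period2 u u'.
have Pv := period_fundamental v.
(* A common period of the three sequences. *)
have {}un := is_period_mul un Pv.1.
have {}u'n := is_period_mul u'n Pv.1.
have vn : is_period v (fundamental_period v * n).
  rewrite mulnC; apply: is_period_mul => //.
  by case: (un); rewrite muln_gt0 => /andP[].
have sn : is_period (a *: u + u' : V R) (fundamental_period v * n).
  split=> [|m]; first exact: un.1.
  by rewrite /= !fctE un.2 u'n.2.
rewrite (innerE sn vn) (innerE un vn) (innerE u'n vn) /mean.
(* Read the scalar action of [R[i]] on [R[i]^o] as multiplication. *)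
rewrite -[RHS]/(a * (_ * _) + _ * _ : R[i]).
rewrite [a * _]mulrCA -mulrDr; congr (_ * _).
rewrite mulr_sumr -big_split/=; apply: eq_bigr => m _.
by rewrite !fctE mulrDl mulrA.
Qed.

Lemma inner0l v : inner 0 v = 0.
Proof.
by have := inner_linear v (-1) 0 0; rewrite scaler0 addr0 scaleN1r addNr.
Qed.

Lemma innerZl a u v : inner (a *: u) v = a * inner u v.
Proof. by rewrite -[a *: u]addr0 inner_linear inner0l addr0. Qed.

Lemma inner_conj u v : inner u v = (inner v u)^*%C.
Proof.
have [n un vn] := common_period2 u v.
rewrite (innerE un vn) (innerE vn un) /mean.
rewrite rmorphM rmorph_sum fmorphV rmorph_nat.
congr (_ * _); apply: eq_bigr => m _.
by rewrite rmorphM [X in _ = _ * X]conjcK mulrC.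
Qed.

Lemma inner_linearr u a v v' :
  inner u (a *: v + v') = a^*%C * inner u v + inner u v'.
Proof.
rewrite inner_conj inner_linear rmorphD rmorphM/=.
by rewrite -!inner_conj.
Qed.

Lemma inner0r u : inner u 0 = 0.
Proof.
by rewrite inner_conj inner0l conjc0.
Qed.

Lemma innerZr a u v : inner u (a *: v) = a^*%C * inner u v.
Proof. by rewrite -[a *: v]addr0 inner_linearr inner0r addr0. Qed.

(** For [f <> f'] the mean [M] of the product satisfies [M = z * M] by
invariance under the shift, where [z = exp (2 pi i (f - f'))] is not [1]. *)
Lemma inner_w (f f' : QZ) (g g' : rat) :
  inner (w R f g) (w R f' g') = (f == f')%:R * e2pi R (g - g').
Proof.
have [n fn f'n] := common_period2 (w R f g) (w R f' g').
rewrite (innerE fn f'n).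
set F := fun m : int => _.
have FE (m : int) : F m = e2pi R ((repr f - repr f') * m%:~R + (g - g')).
  rewrite /F /= /wseq [X in _ * X]conj_e2pi -e2piD; congr (e2pi R _); ring.
have FP : is_period F n by split=> [|m]; [exact: fn.1|rewrite /F fn.2 f'n.2].
have [ff'|ff'] := eqVneq f f'.
  rewrite mul1r /mean (eq_bigr (fun=> e2pi R (g - g'))); last first.
    by move=> m _; rewrite FE ff' subrr mul0r add0r.
  rewrite sumr_const_nat subSS subn0 -[e2pi R _ *+ n]mulr_natl.
  rewrite mulrA mulVf ?mul1r//.
  by rewrite pnatr_eq0 -lt0n; exact: fn.1.
rewrite mul0r; set z := e2pi R (repr f - repr f').
have /eqP : mean F n = z * mean F n.
  rewrite -{1}(mean_shift FP) /mean mulrCA; congr (_ * _).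
  rewrite mulr_sumr; apply: eq_bigr => m _; rewrite !FE -e2piD.
  by congr (e2pi R _); rewrite rmorphD/=; ring.
rewrite -{1}[mean F n]mul1r -subr_eq0 -mulrBl mulf_eq0 subr_eq0 eq_sym.
by case/orP => [/eqP/e2pi_reprB_eq1/eqP|/eqP//]; rewrite (negPf ff').
Qed.

End Averages.

(** * The sieves and their spectral measure *)

Section Sieve.
Variable R : realType.
Implicit Types (f : QZ) (g : rat) (u v Psi : V R) (S T : set QZ).

Lemma w_phase f g : w R f g = e2pi R g *: w R f 0.
Proof.
apply: val_inj; apply/funext => m /=.
by rewrite !fctE /wseq addr0 addrC e2piD.
Qed.

(** Phases are absorbed into the coefficients, so the [w f 0] already span. *)
Lemma V_ind (P : V R -> Prop) :
  P 0 -> (forall a f u, P u -> P (a *: w R f 0 + u)) -> forall u, P u.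
Proof.
move=> P0 PD u.
have [s sE] : exists s : seq (R[i] * (QZ * rat)),
    u = \sum_(t <- s) t.1 *: w R t.2.1 t.2.2.
  case: u => u uV; have /asboolP[s sE] := uV; exists s.
  apply: val_inj; rewrite /= {1}sE.
  by rewrite (big_morph (@sequence_of_V R) (id1 := 0) (op1 := +%R)).
rewrite {}sE; elim: s => [|t s IHs]; first by rewrite big_nil.
by rewrite big_cons w_phase scalerA; exact: PD.
Qed.

Lemma sieve_linear f : linear (sieve R f).
Proof.
move=> a u v; rewrite /sieve.
have -> : inner (a *: u + v) (w R f 0)
        = a * inner u (w R f 0) + inner v (w R f 0).
  exact: inner_linear.
by rewrite scalerDl scalerA.
Qed.

HB.instance Definition _ f :=
  GRing.isLinear.Build R[i] (V R) (V R) *:%R (sieve R f) (sieve_linear f).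

Lemma sieve_w f f' g :
  sieve R f (w R f' g) = ((f == f')%:R * e2pi R g) *: w R f 0.
Proof. by rewrite /sieve inner_w subr0 eq_sym. Qed.

Lemma sieve_support Psi :
  exists2 r : seq QZ, uniq r & forall f, sieve R f Psi != 0 -> f \in r.
Proof.
elim/V_ind: Psi => [|a f u [r ur rP]].
  by exists [::] => // f; rewrite linear0 eqxx.
exists (undup (f :: r)) => [|h]; first exact: undup_uniq.
rewrite mem_undup inE linearP/= sieve_w; case: (eqVneq h f) => // _.
by rewrite mul0r scale0r scaler0 add0r; exact: rP.
Qed.

(** Written over an arbitrary finite sequence containing the support of [Psi],
so that the values at two vectors become sums over the same indices. *)
Lemma spectral_measureE S Psi (r : seq QZ) : uniq r ->
  (forall f, sieve R f Psi != 0 -> f \in r) ->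
  spectral_measure (sieve R) S Psi = \sum_(f <- r | f \in S) sieve R f Psi.
Proof.
move=> ur rP; rewrite /spectral_measure.
rewrite (fsbigE [seq f <- r | f \in S]) ?filter_uniq//.
- by rewrite big_filter_cond; apply: eq_bigl => f; rewrite andbb.
- by move=> f /=; rewrite mem_filter => /andP[/set_mem].
- move=> f Sf; rewrite mem_filter mem_set//= => fr.
  by apply/eqP; apply: contraNT fr; exact: rP.
Qed.

Lemma spectral_measure_linear S : linear (spectral_measure (sieve R) S).
Proof.
move=> a u v.
have [r ur rP] := sieve_support u; have [t ut tP] := sieve_support v.
pose q := undup (r ++ t).
have uq : uniq q by exact: undup_uniq.
have uP f : sieve R f u != 0 -> f \in q.
  by move=> /rP fr; rewrite mem_undup mem_cat fr.
have vP f : sieve R f v != 0 -> f \in q.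
  by move=> /tP ft; rewrite mem_undup mem_cat ft orbT.
have auvP f : sieve R f (a *: u + v) != 0 -> f \in q.
  rewrite linearP/=; case: (eqVneq (sieve R f u) 0) => [->|/uP//].
  by rewrite scaler0 add0r; exact: vP.
rewrite (spectral_measureE S uq auvP) (spectral_measureE S uq uP).
rewrite (spectral_measureE S uq vP) scaler_sumr -big_split/=.
by apply: eq_bigr => f _; rewrite linearP.
Qed.

HB.instance Definition _ S :=
  GRing.isLinear.Build R[i] (V R) (V R) *:%R (spectral_measure (sieve R) S)
    (spectral_measure_linear S).

Lemma spectral_measure_w S f :
  spectral_measure (sieve R) S (w R f 0) = (f \in S)%:R *: w R f 0.
Proof.
rewrite (@spectral_measureE _ _ [:: f])// => [|h].
  rewrite big_mkcond big_seq1 sieve_w eqxx e2pi0 mulr1 scale1r.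
  by case: ifP; rewrite ?scale1r ?scale0r.
by rewrite sieve_w inE; case: (eqVneq h f) => // _; rewrite mul0r scale0r eqxx.
Qed.

Lemma linear_w_ext (A B : V R -> V R) : linear A -> linear B ->
  (forall f, A (w R f 0) = B (w R f 0)) -> A = B.
Proof.
move=> lA lB AB.
pose A' : {linear V R -> V R} := HB.pack A (GRing.isLinear.Build _ _ _ _ A lA).
pose B' : {linear V R -> V R} := HB.pack B (GRing.isLinear.Build _ _ _ _ B lB).
apply/funext => u; elim/V_ind: u => [|a f u IHu].
  by rewrite -[A]/(A' : _ -> _) -[B]/(B' : _ -> _) !linear0.
by rewrite lA lB AB IHu.
Qed.

Lemma spectral_measureI S T :
  spectral_measure (sieve R) (S `&` T)%classic =
  spectral_measure (sieve R) S \o spectral_measure (sieve R) T.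
Proof.
apply: linear_w_ext; first exact: spectral_measure_linear.
  by move=> a u v /=; rewrite 2!spectral_measure_linear.
move=> f.
rewrite /= !spectral_measure_w linearZ/= !spectral_measure_w scalerA.
by rewrite -natrM mulnb in_setI andbC.
Qed.

Lemma spectral_measure_selfadjoint S u v :
  inner (spectral_measure (sieve R) S u) v =
  inner u (spectral_measure (sieve R) S v).
Proof.
elim/V_ind: u => [|a f u IHu].
  by rewrite linear0 !inner0l.
(* Linearity on both sides reduces the claim to [u = w f 0], [v = w h 0]. *)
rewrite linearP/= !inner_linear IHu; congr (a *: _ + _).
elim/V_ind: v {IHu} => [|b h v IHv]; first by rewrite linear0 !inner0r.
rewrite linearP/= !inner_linearr IHv; congr (_ * _ + _).
rewrite !spectral_measure_w.
rewrite innerZl innerZr conjc_nat inner_w.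
by case: eqVneq => [->//|_]; rewrite !mul0r !mulr0.
Qed.

Lemma spectral_measure0 : spectral_measure (sieve R) set0 = fun=> 0.
Proof. by apply/funext => u; rewrite /spectral_measure fsbig_set0. Qed.

Lemma spectral_measureT : spectral_measure (sieve R) setT = id.
Proof.
apply: linear_w_ext => [||f] //; first exact: spectral_measure_linear.
by rewrite spectral_measure_w in_setT scale1r.
Qed.

(** By disjointness a frequency in the union lies in a single [F k0], and the
partial sums at [w f 0] are constant once [n > k0]; a general vector is a
finite combination of such [w f 0]. *)
Lemma sum_spectral_measure_eventually (F : nat -> set QZ) u :
  trivIset setT F -> exists n0, forall n, (n0 <= n)%N ->
    \sum_(k < n) spectral_measure (sieve R) (F k) u =
    spectral_measure (sieve R) (\bigcup_k F k)%classic u.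
Proof.
move=> tF; elim/V_ind: u => [|a f u [n0 IHu]].
  exists 0%N => n _; rewrite linear0 big1// => k _; exact: linear0.
suff [n1 Hf] : exists n1, forall n, (n1 <= n)%N ->
    \sum_(k < n) spectral_measure (sieve R) (F k) (w R f 0) =
    spectral_measure (sieve R) (\bigcup_k F k)%classic (w R f 0).
  exists (maxn n0 n1) => n; rewrite geq_max => /andP[n0n n1n].
  rewrite spectral_measure_linear -(IHu _ n0n) -(Hf _ n1n) scaler_sumr.
  rewrite -big_split/=; apply: eq_bigr => k _.
  exact: spectral_measure_linear.
have [[k0 _ Fk0]|nF] := pselect ((\bigcup_k F k)%classic f); last first.
  exists 0%N => n _; rewrite spectral_measure_w memNset// scale0r big1// => k _.
  by rewrite spectral_measure_w memNset ?scale0r// => Fk; apply: nF; exists k.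
exists k0.+1 => n k0n; rewrite spectral_measure_w mem_set; last by exists k0.
rewrite (bigD1 (Ordinal k0n))//= spectral_measure_w mem_set//.
rewrite big1 ?addr0// => k.
rewrite spectral_measure_w => kk0; rewrite memNset ?scale0r// => Fk.
case/negP: kk0; apply/eqP/val_inj => /=.
by apply: (tF _ _ Logic.I Logic.I); exists f.
Qed.

Lemma normV0 : normV (0 : V R) = 0.
Proof. by rewrite /normV inner0l sqrtr0. Qed.

Lemma sieve_complete_PVM : complete_PVM (sieve R).
Proof.
split=> [Psi|].
  have [r _ rP] := sieve_support Psi.
  by apply: sub_finite_set (finite_seq r) => f /= /rP.
split.
- move=> S; split; first exact: spectral_measure_linear.
    by rewrite -spectral_measureI setIid.
  exact: spectral_measure_selfadjoint.
- exact: spectral_measure0.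
- exact: spectral_measureT.
- exact: spectral_measureI.
move=> F tF Psi; apply: cvg_near_cst.
have [n0 n0P] := sum_spectral_measure_eventually Psi tF.
by exists n0 => // n /= n0n; rewrite n0P// subrr normV0.
Qed.

Lemma sieve_comp f1 f2 :
  sieve R f1 \o sieve R f2 = (fun Psi => (f1 == f2)%:R *: sieve R f1 Psi).
Proof.
apply/funext => Psi /=; rewrite {2}/sieve linearZ/= sieve_w e2pi0 mulr1 scalerA.
rewrite /sieve scalerA.
by case: eqVneq => [->|_]; rewrite ?mulr0 ?mul0r ?mulr1 ?mul1r.
Qed.

Lemma sieve_packet N (c : 'I_N -> R[i]) (f : 'I_N -> QZ) (g : 'I_N -> rat) h :
  sieve R h (\sum_(j < N) c j *: w R (f j) (g j)) =
  \sum_(j < N) (c j * ((h == f j)%:R * e2pi R (g j))) *: w R h 0.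
Proof.
rewrite linear_sum/=; apply: eq_bigr => j _.
by rewrite linearZ/= sieve_w scalerA.
Qed.

End Sieve.

Theorem theorem11p16 (R : realType) :
  (forall (N : nat) (c : 'I_N -> R[i]) (f : 'I_N -> QZ) (g : 'I_N -> rat)
          (f0 : QZ),
      injective f ->
      let Psi : V R := \sum_(j < N) c j *: w R (f j) (g j) in
      (forall j0 : 'I_N, f0 = f j0 ->
         sieve R f0 Psi = (c j0 * e2pi R (g j0)) *: w R f0 0 /\
         (c j0 * e2pi R (g j0)) *: w R f0 0 = c j0 *: w R f0 (g j0)) /\
      ((forall j : 'I_N, f0 <> f j) -> sieve R f0 Psi = 0)) /\
  (forall f1 f2 : QZ,
      sieve R f1 \o sieve R f2
      = (fun Psi : V R => (f1 == f2)%:R *: sieve R f1 Psi)) /\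
  complete_PVM (sieve R).
Proof.
split; last by split; [exact: sieve_comp|exact: sieve_complete_PVM].
move=> N c f g f0 f_inj Psi; split=> [j0 f0E|f0_notin]; last first.
  rewrite /Psi sieve_packet big1// => j _.
  by case: eqP => [/f0_notin//|_]; rewrite mul0r mulr0 scale0r.
split; last by rewrite [in RHS]w_phase scalerA.
rewrite /Psi sieve_packet (bigD1 j0)//= f0E eqxx mul1r big1 ?addr0// => j jj0.
by rewrite (inj_eq f_inj) eq_sym (negPf jj0) mul0r mulr0 scale0r.
Qed.
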